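(* Let $n$ be an integer. For any $\nu$ with $2\le\nu\le n-1$ and any integer $i\ge 1$, define $$S^i_\nu=\{b\in\mathbb{F}_{2^n} : \dim \mathrm{Ker}(P_{\nu,b})=i\}.$$ Then, for any integers $s,t\ge 2$ with $t=n-s+1$ and for any $i$, we have $\#S^i_s=\#S^i_t$.
   Context: For $2\le\nu\le n-1$ and $b\in\mathbb{F}_{2^n}$, $P_{\nu,b}:\mathbb{F}_{2^n}\to\mathbb{F}_{2^n}$ is the $\mathbb{F}_2$-linear map $P_{\nu,b}(x)=x^{2^\nu}+bx^2+(b+1)x$; $\mathrm{Ker}(P_{\nu,b})$ is its kernel in $\mathbb{F}_{2^n}$ and $\dim$ is the dimension over $\mathbb{F}_2$. *)

(* Defs.v *)
From HB Require Import structures.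
From mathcomp Require Import all_boot all_order all_algebra all_fingroup all_field.
Set Implicit Arguments.
Unset Strict Implicit.
Unset Printing Implicit Defensive.
Import GRing.Theory.
Local Open Scope ring_scope.

Definition P_fun (L : fieldExtType 'F_2) (nu : nat) (b x : L) : L :=
  x ^+ (2 ^ nu) + b * x ^+ 2 + (b + 1) * x.

Lemma pchar2 (L : fieldExtType 'F_2) : 2 \in [pchar L].
Proof. by rewrite pchar_lalg pchar_Fp. Qed.

Lemma expr2X_linear (L : fieldExtType 'F_2) (k : nat) :
  linear (fun x : L => x ^+ (2 ^ k)).
Proof.
have ch := pchar2 L.
elim: k => [|k IHk] a x y; first by rewrite expn0 !expr1.
rewrite expnSr !exprM IHk exprDn_pchar ?pnatX ?pnat_id //; last first.
  by rewrite pnatE.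
rewrite exprZn; congr (_ *: _ + _).
have := expf_card a; by rewrite card_Fp.
Qed.

Lemma P_fun_linear (L : fieldExtType 'F_2) (nu : nat) (b : L) :
  linear (P_fun nu b).
Proof.
move=> a x y; rewrite /P_fun.
have F2 := @expr2X_linear L 1 a x y; rewrite /= expn1 in F2.
rewrite expr2X_linear F2 !mulrDr -!scalerAr !scalerDr.
by rewrite [RHS]addrACA; congr (_ + _); exact: addrACA.
Qed.

HB.instance Definition _ (L : fieldExtType 'F_2) (nu : nat) (b : L) :=
  GRing.isLinear.Build 'F_2 L L *:%R (P_fun nu b) (P_fun_linear nu b).

(* [linfun] returns a junk value on non-linear functions; [P_fun] is linear by
   the instance above, so [P nu b] and [P_fun nu b] agree ([P_E]). *)
Definition P (L : fieldExtType 'F_2) (nu : nat) (b : L) : 'End(L) :=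
  linfun (P_fun nu b).

Lemma P_E (L : fieldExtType 'F_2) (nu : nat) (b x : L) :
  P nu b x = x ^+ (2 ^ nu) + b * x ^+ 2 + (b + 1) * x.
Proof. by rewrite lfunE. Qed.

(* [finvect_type L] is [L] itself, equipped with its finite type structure. *)
Definition S_set (L : fieldExtType 'F_2) (nu i : nat) : {set finvect_type L} :=
  [set b : finvect_type L | \dim (lker (P nu (b : L))) == i].

(* Main.v *)
Require Import Defs.
From mathcomp Require Import all_boot all_order all_algebra all_fingroup all_field.
From mathcomp Require Import ring zify.
Set Implicit Arguments.
Unset Strict Implicit.
Unset Printing Implicit Defensive.
Import GRing.Theory.
Local Open Scope ring_scope.

(* With [s + t = n + 1], the adjoint of [P_{s,b}] for the trace form, squared, is
   [A_{t,b}(y) = y^(2^t) + (b+1)^2 y^2 + b y], so both maps have kernels of the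
   same size. For a nonzero [l] in [Ker A_{t,b}], the substitution [y = l z]
   turns [A_{t,b}] into a multiple of [P_{t,c}], where
   [c = (b+1)^2 l^2 / l^(2^t)]; moreover [l^(2^t)] is then a zero of [A_{s,c}].
   Hence [(b, l) |-> (c, l^(2^t))] injects the pairs [(b, l)] with
   [dim Ker P_{s,b} = i] and [0 != l \in Ker A_{t,b}] into the same kind of pairs
   with [s] and [t] exchanged. There are [#S^i_s * (2^i - 1)] of the former, so
   [#S^i_s <= #S^i_t], and the roles of [s] and [t] are symmetric. *)

(* Double counting of the pairs [(x, y)] with [T (f x * y) = 0]. *)
Lemma card_zeros_adjoint (F : finFieldType) (T f g phi : F -> F) (y0 : F) :
    T 0 = 0 -> T y0 != 0 -> injective phi ->
    (forall x y, T (f x * y) = T (phi x * g y)) ->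
  #|[set x | f x == 0]| = #|[set y | g y == 0]|.
Proof.
move=> T0 Ty0 phi_inj adj.
pose K := (\sum_y (T y == 0%R))%N.
(* The strict inequality, due to [y0], makes the factor [#|F| - K] positive, so that the number of
   zeros of [h] can be recovered from the sum in [total]. *)
have ltK : (K < #|F|)%N.
  rewrite -sum1_card (bigD1 y0) //= /K [X in (X < _)%N](bigD1 y0) //= (negPf Ty0).
  by rewrite add0n add1n ltnS leq_sum // => y _; apply: leq_b1.
have countr (a : F) : (\sum_y (T (y * a)%R == 0%R) = if a == 0%R then #|F| else K)%N.
  have [-> | a_neq0] := eqVneq a 0.
    by rewrite -sum1_card; apply: eq_bigr => y _; rewrite mulr0 T0 eqxx.
  by rewrite [RHS](reindex_inj (mulIf a_neq0)).
have total (h : F -> F) :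
    (\sum_x (if h x == 0%R then #|F| else K)
     = #|[set x | h x == 0%R]| * (#|F| - K) + #|F| * K)%N.
  transitivity (\sum_x ((h x == 0%R) * (#|F| - K) + K))%N.
    by apply: eq_bigr => x _; case: eqP; rewrite ?mul1n ?subnK // ltnW.
  rewrite big_split /= -big_distrl /= sum_nat_const.
  by rewrite -sum1dep_card [in RHS]big_mkcond.
have : (\sum_x \sum_y (T (y * f x)%R == 0%R)
        = \sum_x \sum_y (T (y * g x)%R == 0%R))%N.
  rewrite [RHS]exchange_big /= [RHS](reindex_inj phi_inj) /=.
  by apply: eq_bigr => x _; apply: eq_bigr => y _; rewrite mulrC adj.
under eq_bigr do rewrite countr; under [in RHS]eq_bigr do rewrite countr.
rewrite !total => /addIn/eqP; rewrite eqn_pmul2r ?subn_gt0 //.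
by move/eqP.
Qed.

Lemma card_dep_pairs (I J : finType) (A : {set I}) (B : I -> {set J}) (m : nat) :
    (forall i, i \in A -> #|B i| = m) ->
  #|[set p : I * J | (p.1 \in A) && (p.2 \in B p.1)]| = (#|A| * m)%N.
Proof.
move=> cardB; rewrite -sum_nat_const -sum1dep_card.
rewrite -(pair_big_dep (mem A) (fun i j => j \in B i) (fun _ _ => 1%N)) /=.
by apply: eq_bigr => i /cardB <-; rewrite sum1_card.
Qed.

Section FiniteField.
Variables (F : finFieldType) (n : nat).
Hypotheses (char2 : 2 \in [pchar F]) (cardF : #|F| = (2 ^ n)%N).

Let trace (x : F) : F := \sum_(i < n) x ^+ (2 ^ i).

Lemma frobeniusD k : {morph (fun x : F => x ^+ (2 ^ k)) : x y / x + y}.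
Proof.
by move=> x y; rewrite exprDn_pchar // pnatX; apply/orP; left; rewrite pnatE.
Qed.

Lemma frobenius_inj k : injective (fun x : F => x ^+ (2 ^ k)).
Proof.
move=> x y /= /eqP; rewrite -subr_eq0 oppr_pchar2 // -frobeniusD expf_eq0.
by rewrite expn_gt0 /= -[y]oppr_pchar2 // subr_eq0 oppr_pchar2 // => /eqP.
Qed.

Lemma expr_card2 x : x ^+ (2 ^ n) = x :> F.
Proof. by rewrite -cardF expf_card. Qed.

Lemma n_gt0 : (0 < n)%N.
Proof.
have := finNzRing_gt1 F; rewrite cardF; by case: (n).
Qed.

Lemma trace0 : trace 0 = 0.
Proof.
by rewrite /trace big1 // => i _; rewrite expr0n expn_eq0.
Qed.

Lemma traceD : {morph trace : x y / x + y}.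
Proof.
by move=> x y; rewrite -big_split; apply: eq_bigr => i _; apply: frobeniusD.
Qed.

(** Since [x^(2^n) = x], each squaring permutes the summands of the trace cyclically. *)
Lemma trace_frobenius k x : trace (x ^+ (2 ^ k)) = trace x.
Proof.
elim: k => [|k IHk]; first by rewrite expr1.
rewrite expnS mulnC exprM -[RHS]IHk; move: (x ^+ _) => {IHk}x.
have:= n_gt0; rewrite /trace; move: expr_card2; case: (n) => // m Fm _.
rewrite big_ord_recr [RHS]big_ord_recl /= addrC -exprM -expnS Fm expr1.
by congr (_ + _); apply: eq_bigr => i _; rewrite -exprM -expnS.
Qed.

(** The trace is a polynomial of degree [2^(n-1)], too small to vanish at all [2^n] elements of
    [F]. *)
Lemma trace_neq0 : exists y, trace y != 0.
Proof.
apply/existsP; apply: contraT; rewrite negb_exists => /forallP tr0.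
pose p : {poly F} := \sum_(i < n) 'X^(2 ^ i).
have size_p : size p = (2 ^ n.-1).+1.
  have:= n_gt0; rewrite /p; case: (n) => // m _.
  rewrite big_ord_recr /= addrC size_polyDl size_polyXn // ltnS.
  apply: (leq_trans (size_sum _ _ _)); apply/bigmax_leqP => i _.
  by rewrite size_polyXn ltn_exp2l.
have p_neq0 : p != 0 by rewrite -size_poly_eq0 size_p.
have /(max_poly_roots p_neq0) : all (root p) (enum F).
  apply/allP => x _; rewrite rootE horner_sum; move: (tr0 x).
  by rewrite negbK /trace; under eq_bigr do rewrite -hornerXn.
rewrite enum_uniq -cardE cardF size_p => /(_ isT).
rewrite ltnS leq_exp2l //; have := n_gt0; lia.
Qed.

Definition Pmap s (b x : F) := x ^+ (2 ^ s) + b * x ^+ 2 + (b + 1) * x.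
Definition Amap t (b y : F) := y ^+ (2 ^ t) + (b + 1) ^+ 2 * y ^+ 2 + b * y.
(** The index [k] is the size of the kernel, not its dimension: [k = 2^i] corresponds to dimension
    [i]. *)
Definition Sfin s k := [set b | #|[set x | Pmap s b x == 0]| == k].

Section Pairs.
Variables (s t : nat).
Hypotheses (st : (s + t = n.+1)%N).

Lemma expr_st x : (x ^+ (2 ^ s)) ^+ (2 ^ t) = x ^+ 2 :> F.
Proof. by rewrite -exprM -expnD st expnS mulnC exprM expr_card2. Qed.

(** The trace is invariant under Frobenius: raise [x^(2^s) * y] to the power [2^t], square
    [(b + 1) * x * y], and keep [b * x^2 * y]. Each term then has the factor [x^2]. *)
Lemma trace_adjoint b x y :
  trace (Pmap s b x * y) = trace (x ^+ 2 * Amap t b y).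
Proof.
rewrite /Pmap /Amap !(mulrDl _ _ y) !(mulrDr (x ^+ 2)) !traceD.
rewrite -(trace_frobenius t (x ^+ (2 ^ s) * y)) -(trace_frobenius 1 (_ * x * y)).
rewrite exprMn expr_st expn1 -!addrA; congr (_ + _).
by rewrite addrC; congr (trace _ + trace _); ring.
Qed.

Lemma card_ker_adjoint b :
  #|[set x | Pmap s b x == 0]| = #|[set y | Amap t b y == 0]|.
Proof.
have [y0 Ty0] := trace_neq0.
apply: (card_zeros_adjoint (phi := fun x => x ^+ 2) trace0 Ty0).
  exact: (@frobenius_inj 1).
exact: trace_adjoint.
Qed.

Definition twist b l : F := (b + 1) ^+ 2 * l ^+ 2 / l ^+ (2 ^ t).

Lemma twistE b l : l != 0 -> twist b l * l ^+ (2 ^ t) = (b + 1) ^+ 2 * l ^+ 2.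
Proof. by move=> l0; rewrite mulfVK ?expf_neq0. Qed.

(** This is where [l] has to be a zero of [A_{t,b}]: it makes the linear coefficient of
    [A_{t,b}(l z) / l^(2^t)] equal to [c + 1], as the shape of [P_{t,c}] demands. *)
Lemma twist1E b l : l != 0 -> Amap t b l = 0 ->
  (twist b l + 1) * l ^+ (2 ^ t) = b * l.
Proof.
move=> l0 Al0; rewrite mulrDl mul1r twistE //; apply/eqP.
by rewrite -subr_eq0 oppr_pchar2 // [_ + l ^+ _]addrC; apply/eqP.
Qed.

Lemma twistP b l z : l != 0 -> Amap t b l = 0 ->
  Pmap t (twist b l) z * l ^+ (2 ^ t) = Amap t b (l * z).
Proof.
move=> l0 Al0.
rewrite /Pmap /Amap !exprMn !(mulrDl _ _ (l ^+ (2 ^ t))).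
rewrite (mulrAC (twist b l)) (mulrAC (twist b l + 1)) twistE ?twist1E //.
by rewrite (mulrC (z ^+ _)) !mulrA.
Qed.

Lemma card_ker_twist b l : l != 0 -> Amap t b l = 0 ->
  #|[set z | Pmap t (twist b l) z == 0]| = #|[set x | Pmap s b x == 0]|.
Proof.
move=> l0 Al0; rewrite card_ker_adjoint -(card_imset _ (mulfI l0)).
apply: eq_card => y; rewrite [RHS]inE; apply/imsetP/idP => [[z + ->]|Ay].
  by rewrite inE -twistP // => /eqP->; rewrite mul0r.
exists (l^-1 * y); last by rewrite mulVKf.
rewrite inE -(mulIr_eq0 _ (mulIf (expf_neq0 (2 ^ t) l0))) twistP //.
by rewrite mulVKf.
Qed.

End Pairs.

Definition Xset s t k : {set F * F} :=
  [set p | (p.1 \in Sfin s k) && (p.2 \in [set l | Amap t p.1 l == 0] :\ 0)].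

Lemma card_Xset s t k : (s + t = n.+1)%N ->
  #|Xset s t k| = (#|Sfin s k| * k.-1)%N.
Proof.
move=> st; apply: (card_dep_pairs
  (B := fun b => [set l | Amap t b l == 0] :\ 0)) => b.
rewrite inE (card_ker_adjoint st) => /eqP <-.
rewrite [in RHS](cardsD1 0) inE /Amap !expr0n expn_eq0 /=.
by rewrite !mulr0 !addr0 eqxx.
Qed.

Lemma leq_card_Xset s t k : (s + t = n.+1)%N -> (#|Xset s t k| <= #|Xset t s k|)%N.
Proof.
move=> st; pose h p : F * F := (twist t p.1 p.2, p.2 ^+ (2 ^ t)).
(* The second component determines [l] by injectivity of Frobenius; given [l], the first determines
   [(b + 1)^2], hence [b]. *)
have hinj : {in Xset s t k &, injective h}.
  move=> [b l] [b' l']; rewrite !inE /= => /and3P[_ l0 _] _ [+ /frobenius_inj ll'].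
  rewrite -{}ll' => /(mulIf (invr_neq0 (expf_neq0 _ l0))).
  by move=> /(mulIf (expf_neq0 2 l0)) /(@frobenius_inj 1) /addIr ->.
rewrite -(card_in_imset hinj); apply/subset_leq_card/subsetP => _ /imsetP[[b l] + ->].
rewrite !inE /= => /and3P[cb l0 /eqP Al0]; rewrite (card_ker_twist st) // cb /=.
rewrite expf_neq0 //= /Amap expr_st; last by rewrite addnC.
rewrite -exprMn twist1E // twistE //; apply/eqP.
(* The left side is [A_{s,c}] evaluated at [l^(2^t)]; being a double, it vanishes in characteristic
   2. *)
have -> : l ^+ 2 + (b * l) ^+ 2 + (b + 1) ^+ 2 * l ^+ 2
  = ((1 + b + b ^+ 2) * l ^+ 2) *+ 2 by ring.
exact: mulrn_pchar.
Qed.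

Lemma card_Sfin s t k : (s + t = n.+1)%N -> (1 < k)%N ->
  #|Sfin s k| = #|Sfin t k|.
Proof.
move=> st k_gt1; have ts : (t + s = n.+1)%N by rewrite addnC.
(* The factor [k.-1] counts the nonzero [l] attached to each [b]; it can be cancelled because
   [1 < k]. *)
apply/eqP; rewrite -(eqn_pmul2r (m := k.-1)); last by case: k k_gt1 => [|[]].
by rewrite -(card_Xset k st) -(card_Xset k ts) eqn_leq !leq_card_Xset.
Qed.

End FiniteField.

Theorem theorem4 (n : nat) (L : fieldExtType 'F_2) (dimL : \dim {:L} = n)
    (s t i : nat) (s_ge2 : (2 <= s)%N) (t_ge2 : (2 <= t)%N)
    (t_def : t = (n - s + 1)%N) (i_ge1 : (1 <= i)%N) :
  #|S_set L s i| = #|S_set L t i|.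
Proof.
have ch : 2 \in [pchar (finvect_type L)] by exact: pchar2.
have cardV (V : {vspace finvect_type L}) : #|V| = (2 ^ \dim V)%N.
  by rewrite card_vspace card_Fp.
have cardL : #|finvect_type L| = (2 ^ n)%N.
  by rewrite -dimL -(cardV fullv); apply: eq_card => x; rewrite memvf.
have SE nu : S_set L nu i = Sfin (finvect_type L) nu (2 ^ i)%N.
  apply/setP => b; rewrite !inE -[LHS](eqn_exp2l _ _ (ltnSn 1)).
  congr (_ == _); apply: etrans (esym (cardV (lker (P nu (b : L))))) _.
  by apply: eq_card => x; rewrite memv_ker inE P_E.
(* The subtraction [n - s] is truncated, but [2 <= t] forces [s < n], so [s + t = n + 1] does
   hold. *)
rewrite !SE; apply: (card_Sfin ch cardL); first lia.
by rewrite -{1}(expn0 2) ltn_exp2l.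
Qed.
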